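(* Let $K$ be a compact Hausdorff space, $m$ a positive integer, and let $(f_s)_{s\in S}$, $f_s:K\to\mathbb{R}^m$, be a normalized family of continuous functions. Assume that for every maximal chain $\beta$ of $S$, the sequence $(f_s)_{s\in\beta}$ is uniformly bounded and converges pointwise to zero. Assume furthermore that for every maximal chain $\beta$ of $S$ there are a null sequence $(\epsilon^\beta_n)_{n\ge 0}$ of positive real numbers and a constant $\mu^\beta>0$ such that for every $s\in\beta$ and every $x\in K$ either $\|f_s(x)\|\le\epsilon^\beta_{\mathrm{lev}(s)}$ or $\|f_s(x)\|\ge\mu^\beta$. Then there exist a subtree $T$ of $S$ and a constant $C\ge1$ such that for every chain $\beta$ of $T$, $(f_s)_{s\in\beta}$ is a $C$-unconditional sequence.
   Context: $S=\bigcup_{n=0}^\infty\{0,1\}^n$ is the dyadic tree of all finite sequences in $\{0,1\}$ (including the empty one), partially ordered by the initial segment relation $\le$. The level of $s\in\{0,1\}^n$ is $\mathrm{lev}(s)=n$. A subtree of $S$ is a subset $T\subseteq S$, with the induced order, which has a single minimal element and in which every element has exactly two immediate successors (i.e. for each $t\in T$ there are exactly two minimal elements of $\{t'\in T: t<t'\}$); thus $T$ is order isomorphic to $S$. A chain of a tree $T$ is an infinite linearly ordered subset of $T$; a maximal chain is one that is maximal under inclusion. For a chain $\beta$ with elements enumerated increasingly as $s_1<s_2<\cdots$, $(f_s)_{s\in\beta}$ denotes the sequence $(f_{s_i})_{i=1}^\infty$. $\mathbb{R}^m$ carries its usual norm $\|\cdot\|$, and continuous functions $f:K\to\mathbb{R}^m$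 are regarded as elements of the Banach space $C(K,\mathbb{R}^m)$ with norm $\|f\|=\sup_{x\in K}\|f(x)\|$; normalized means $\|f_s\|=1$ for all $s$. A sequence $(y_i)$ in a Banach space is $C$-unconditional if for every $n\in\mathbb{N}$, all $a_1,\ldots,a_n\in\mathbb{R}$ and every $A\subseteq\{1,\ldots,n\}$, $\|\sum_{i\in A}a_iy_i\|\le C\|\sum_{i=1}^na_iy_i\|$. *)

(* Defs.v *)
From mathcomp Require Import all_boot all_order all_algebra.
From mathcomp Require Import all_classical all_reals all_analysis.
Import Order.TTheory GRing.Theory Num.Theory.
Import numFieldNormedType.Exports.

Set Implicit Arguments.
Unset Strict Implicit.
Unset Printing Implicit Defensive.

Local Open Scope classical_set_scope.
Local Open Scope ring_scope.

(* The dyadic tree S is the type [seq bool], ordered by [prefix] (initial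
   segment); the level of a node is its [size]. *)
Definition node : Type := seq bool.

Definition sprefix (s t : node) : bool := (s != t) && prefix s t.

Definition minimal_elements (A : set node) : set node :=
  [set s | A s /\ forall t, A t -> ~~ sprefix t s].

Definition subtree (T : set node) : Prop :=
  (exists r, minimal_elements T = [set r]) /\
  (forall t, T t -> exists a b, a <> b /\
     minimal_elements [set u | T u /\ sprefix t u] = [set a; b]).

Definition chain (T beta : set node) : Prop :=
  [/\ beta `<=` T, infinite_set beta & total_on beta (fun s t => prefix s t)].

Definition maximal_chain (T beta : set node) : Prop :=
  chain T beta /\ forall gamma, chain T gamma -> beta `<=` gamma -> gamma = beta.

(* [e] lists the elements of [beta] in increasing order; by
   [chain_enumeration] every chain has exactly one such listing. *)
Definition enumerates (e : nat -> node) (beta : set node) : Prop :=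
  (forall i, sprefix (e i) (e i.+1)) /\ range e = beta.

(* The Euclidean norm; the library's norm on ['rV[R]_m] is the maximum norm. *)
Definition enorm (R : realType) (m : nat) (v : 'rV[R]_m) : R :=
  Num.sqrt (\sum_(j < m) v 0 j ^+ 2).

Definition supnorm (R : realType) (K : Type) (m : nat) (f : K -> 'rV[R]_m) : R :=
  sup (range (fun x => enorm (f x))).

Definition unconditional (R : realType) (V : lmodType R) (N : V -> R) (C : R)
    (y : nat -> V) : Prop :=
  forall (n : nat) (a : 'I_n -> R) (A : {set 'I_n}),
    N (\sum_(i in A) a i *: y i) <= C * N (\sum_(i < n) a i *: y i).

Lemma sprefix_size s t : sprefix s t -> (size s < size t)%N.
Proof.
case/andP=> st /prefixP[u tE]; move: st; rewrite tE size_cat.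
by case: u {tE} => [|x u]; rewrite ?cats0 ?eqxx //= addnS ltnS leq_addr.
Qed.

Lemma chain_size_inj T beta s t : chain T beta ->
  beta s -> beta t -> size s = size t -> s = t.
Proof.
case=> _ _ tot bs bt sz.
have pE (u v : node) : size u = size v -> prefix u v -> u = v.
  move=> uv; rewrite prefixE uv take_size => /eqP; exact: esym.
by case: (tot _ _ bs bt) => /pE ->.
Qed.

Lemma chain_size_lt T beta s t : chain T beta ->
  beta s -> beta t -> (size s < size t)%N -> sprefix s t.
Proof.
move=> [_ _ tot] bs bt st; rewrite /sprefix; apply/andP; split.
  by apply: contraTneq st => ->; rewrite ltnn.
case: (tot _ _ bs bt) => // /prefixP[u sE].
by move: st; rewrite sE size_cat ltnNge leq_addr.
Qed.

Lemma chain_unbounded T beta : chain T beta ->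
  forall k, exists2 s, beta s & (k <= size s)%N.
Proof.
move=> cb k; apply: contrapT => nex.
have [_ inf _] := cb; apply: inf.
have bk s : beta s -> (size s < k)%N.
  by move=> bs; rewrite ltnNge; apply/negP => ks; apply: nex; exists s.
pose g n := xget [::] [set s | beta s /\ size s = n].
apply: (@sub_finite_set _ _ (g @` `I_k)); last exact/finite_image/finite_II.
move=> s bs; exists (size s); first exact: bk.
have [|bg gE] := @xgetPex _ [::] [set t | beta t /\ size t = size s].
  by exists s.
exact: chain_size_inj cb bg bs gE.
Qed.

Lemma chain_least T beta : chain T beta -> forall k, exists s,
  [/\ beta s, (k <= size s)%N &
      forall t, beta t -> (k <= size t)%N -> (size s <= size t)%N].
Proof.
move=> cb k.
have ex : exists n, `[< exists s, [/\ beta s, size s = n & (k <= n)%N] >].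
  by have [s bs ks] := chain_unbounded cb k; exists (size s); apply/asboolP; exists s.
case: (ex_minnP ex) => n /asboolP[s [bs <- kn]] nmin.
by exists s; split=> // t bt kt; apply: nmin; apply/asboolP; exists t.
Qed.

Lemma enumerates_size e beta : enumerates e beta ->
  forall i j, (i < j)%N -> (size (e i) < size (e j))%N.
Proof.
move=> [inc _] i; elim=> // j IH; rewrite ltnS leq_eqVlt => /orP[/eqP->|ij].
  exact: sprefix_size.
by apply: ltn_trans (IH ij) _; exact: sprefix_size.
Qed.

Lemma enumerates_size_le T beta e e' i : chain T beta ->
  enumerates e beta -> enumerates e' beta ->
  (forall j, (j < i)%N -> e j = e' j) -> (size (e' i) <= size (e i))%N.
Proof.
move=> cb ee ee' eq.
have : range e' (e i) by rewrite (proj2 ee') -(proj2 ee); exists i.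
case=> k _ kE; case: (ltnP k i) => [ki|].
  have := enumerates_size ee ki; rewrite eq // kE ltnn //.
rewrite -kE leq_eqVlt => /orP[/eqP-> //|ik].
exact/ltnW/(enumerates_size ee').
Qed.

Lemma chain_enumeration T beta : chain T beta -> exists! e, enumerates e beta.
Proof.
move=> cb; have [g gP] := choice (chain_least cb).
pose e := fix F n := if n is p.+1 then g (size (F p)).+1 else g 0%N.
have be i : beta (e i).
  by case: i => [|i]; [have [] := gP 0%N | have [] := gP (size (e i)).+1].
have einc i : (size (e i) < size (e i.+1))%N.
  by have [] := gP (size (e i)).+1.
have ege i : (i <= size (e i))%N.
  by elim: i => // i IH; apply: leq_ltn_trans IH (einc i).
have ee : enumerates e beta.
  split=> [i|]; first exact: chain_size_lt cb (be _) (be _) (einc i).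
  apply/seteqP; split=> [_ [i _ <-] //|t bt].
  have ex : exists i, (size t <= size (e i))%N by exists (size t).
  case: (ex_minnP ex) => i ti imin; exists i => //.
  apply: (chain_size_inj cb (be i) bt); apply/eqP; rewrite eqn_leq ti andbT.
  case: i ti imin => [|i] ti imin.
    by have [_ _ gmin] := gP 0%N; exact: gmin.
  have [_ _ gmin] := gP (size (e i)).+1; apply: gmin => //.
  by rewrite ltnNge; apply/negP => /imin; rewrite ltnn.
exists e; split=> // e' ee'; apply/funext => i.
elim/ltn_ind: i => i IH; apply: (chain_size_inj cb (be i)).
  by rewrite -(proj2 ee'); exists i.
apply/eqP; rewrite eqn_leq (enumerates_size_le cb ee' ee) => [|j /IH//].
by rewrite (enumerates_size_le cb ee ee').
Qed.

(* Main.v *)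
(* After discarding nodes, the gap condition holds with one mu and with errors
   that are summable along every chain.  Put H_s = {|f_s| >= mu} and, for a
   coordinate j and a sign, G_s = {+-f_s(.)_j >= mu/m}; these G_s cover H_s.  It
   suffices to find a subtree in which, whenever some point lies in G_s for all
   s in a finite set A of predecessors of a node, some point lies in G_s for
   s in A and outside H_s for the other predecessors: splitting A according to
   j and to the signs then bounds sum |a_i| by the norm of sum a_i f_i.

   This hereditary property is a Ramsey statement about chains of the tree.  It
   is obtained from an ultrafilter p on the words, idempotent for concatenation,
   where "c in D for p-almost all c" plays the role of shrinking to a subtree: a
   pair (F, F') is bad at a if a p-branching tree above a has all its branches
   reaching a chain A with F meeting the G_s (s in A) jointly but F' not.
   Idempotence makes badness and its negation persist to almost all extensions,
   and since H_s is eventually missed along every branch, (F, F \ H_b) is not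
   bad for almost all b.  The subtree is then built node by node, keeping all
   the relevant pairs not bad. *)
Require Import Defs.
From Stdlib Require List.
From mathcomp Require Import all_boot all_order all_algebra.
From mathcomp Require Import all_classical all_reals all_analysis.
From mathcomp Require Import ring lra.
Import Order.TTheory GRing.Theory Num.Theory.
Import numFieldNormedType.Exports.

Set Implicit Arguments.
Unset Strict Implicit.
Unset Printing Implicit Defensive.

Local Open Scope classical_set_scope.

(** * Ultrafilters *)

Lemma filter_setC_false T (F : set_system T) (A : set T) :
  ProperFilter F -> F A -> F (~` A) -> False.
Proof.
move=> PF FA FnA; apply: (@filter_not_empty _ F).
by rewrite -(setICr A); exact: filterI.
Qed.

(** If [A] were not in [F], then [F] and the complement of [A] would generate a proper filter,
    contained in some ultrafilter. *)
Lemma proper_filter_ultra_ext T (F : set_system T) (A : set T) :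
  ProperFilter F -> (forall q, UltraFilter q -> F `<=` q -> q A) -> F A.
Proof.
move=> PF uA; apply: contrapT => nFA.
have PG : ProperFilter (filter_from F (fun B => B `&` ~` A)).
  apply: filter_from_proper => [|B FB].
    apply: filter_from_filter => [|B C FB FC]; first by exists setT; apply: filterT.
    by exists (B `&` C); [exact: filterI|move=> x [[Bx Cx] nAx]].
  apply: contrapT => B0; apply: nFA; apply: filterS FB => x Bx.
  by apply: contrapT => nAx; apply: B0; exists x.
have [q [uq Gq]] := ultraFilterLemma PG.
have qA : q A by apply: uA => // B FB; apply: Gq; exists B => // x [].
have qnA : q (~` A) by apply: Gq; exists setT; [apply: filterT|move=> x []].
exact: filter_setC_false qA qnA.
Qed.

Lemma ultra_sub_eq T (p q : set_system T) :
  UltraFilter p -> ProperFilter q -> p `<=` q -> q = p.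
Proof. by move=> up pq; exact: max_filter. Qed.

Lemma ultraI T (p : set_system T) : ProperFilter p ->
  (forall A, p A \/ p (~` A)) -> UltraFilter p.
Proof.
move=> Pp pA; split=> // G PG pG; apply/seteqP; split=> // A GA.
have [//|/pG GnA] := pA A.
by case: (filter_setC_false PG GA GnA).
Qed.

Lemma ultra_setC T (p : set_system T) A : UltraFilter p -> ~ p A -> p (~` A).
Proof. by move=> up npA; have [] := in_ultra_setVsetC A up. Qed.

(** * Convolution of ultrafilters and idempotents *)

Section Idempotent.
Variables (T : Type) (op : T -> T -> T).
Hypothesis opA : associative op.

Definition fshift (a : T) (D : set T) : set T := [set c | D (op a c)].
(** On ultrafilters, this is the product of the Stone-Cech compactification that extends [op],
    continuous in the left factor. *)
Definition fmul (p q : set_system T) : set_system T :=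
  [set D | p [set a | q (fshift a D)]].

Lemma fmul_proper p q : ProperFilter p -> ProperFilter q -> ProperFilter (fmul p q).
Proof.
move=> Pp Pq; apply: Build_ProperFilter_ex.
  move=> D pD; have [a qa] := filter_ex (pD : p _).
  by have [c Dac] := filter_ex qa; exists (op a c).
split.
- by rewrite /fmul /=; apply: filterE => a; apply: filterT.
- move=> A B pA pB; apply: (@filterS _ p) (filterI (pA : p _) (pB : p _)) => a [].
  exact: filterI.
- by move=> A B AB; apply: (@filterS _ p) => a; apply: filterS => c; exact: AB.
Qed.

Lemma fmul_ultra p q : UltraFilter p -> UltraFilter q -> UltraFilter (fmul p q).
Proof.
move=> up uq; apply: ultraI; first exact: fmul_proper.
move=> A; have [?|pn] := in_ultra_setVsetC [set a | q (fshift a A)] up; first by left.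
by right; apply: filterS pn => a; exact: ultra_setC.
Qed.

Lemma fshiftM a b D : fshift b (fshift a D) = fshift (op a b) D.
Proof. by apply/seteqP; split=> c; rewrite /fshift /= opA. Qed.

Lemma fmulA p q r : fmul p (fmul q r) = fmul (fmul p q) r.
Proof.
apply/funext => D; congr (p _); apply/funext => a; congr (q _).
by apply/funext => b; congr (r _); exact: fshiftM.
Qed.

(** Right multiplication by [p] is continuous on a compact space, so the image of the closed set
    given by [F] is closed. Concretely, the sets [B (C, D)] have the finite intersection property,
    and any ultrafilter containing them is a factor. *)
Lemma fmul_factor F p q : ProperFilter F -> UltraFilter p -> UltraFilter q ->
  fmul F p `<=` q -> exists r, [/\ UltraFilter r, F `<=` r & fmul r p = q].
Proof.
move=> PF up uq Fq.
pose B (X : set T * set T) := X.1 `&` [set a | p (fshift a X.2)].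
have PG : ProperFilter (filter_from [set X | F X.1 /\ q X.2] B).
  apply: filter_from_proper => [|[C D] [/= FC qD]].
    apply: filter_from_filter => [|[C D] [C' D'] [/= FC qD] [FC' qD']].
      by exists (setT, setT); split=> /=; exact: filterT.
    exists (C `&` C', D `&` D') => /=; first by split; exact: filterI.
    move=> a [/= [Ca C'a] pD]; split; split=> //=;
      by apply: filterS pD => c [].
  apply: contrapT => B0.
  have /Fq qnD : fmul F p (~` D).
    apply: (@filterS _ F) FC => a Ca /=; apply: ultra_setC => pD.
    by apply: B0; exists a.
  exact: filter_setC_false qD qnD.
have [r [ur Gr]] := ultraFilterLemma PG; exists r; split=> //.
  by move=> C FC; apply: Gr; exists (C, setT) => [|a []//]; split=> //; exact: filterT.
apply: ultra_sub_eq; first exact: fmul_proper.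
by move=> D qD; apply: Gr; exists (setT, D) => [|a []//]; split=> //; exact: filterT.
Qed.

(** Such a filter represents a nonempty closed subsemigroup of the ultrafilters. *)
Definition semigroup_filter (F : set_system T) :=
  ProperFilter F /\
  forall p q, UltraFilter p -> UltraFilter q -> F `<=` p -> F `<=` q ->
    F `<=` fmul p q.

(* Ellis's theorem: filters stand for the closed sets of ultrafilters. *)
Lemma idempotent_ultrafilter F0 : semigroup_filter F0 ->
  exists p, [/\ UltraFilter p, F0 `<=` p & fmul p p = p].
Proof.
move=> sF0.
(* A maximal filter is a minimal closed subsemigroup. The alternative [set0] gives the empty chain
   its union in Zorn's lemma. *)
have [F [sF F0F Fmax]] : exists F, [/\ semigroup_filter F, F0 `<=` F &
    forall G, semigroup_filter G -> F `<=` G -> G = F].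
  have [|A [PA Amax]] := @Zorn_bigcup _
      (fun F => F = set0 \/ semigroup_filter F /\ F0 `<=` F).
    move=> C CP Ctot.
    have [[G [CG sG F0G]]|no] :=
        pselect (exists G, [/\ C G, semigroup_filter G & F0 `<=` G]); last first.
      left; apply/seteqP; split=> // D [G CG GD].
      have [G0|[sG F0G]] := CP _ CG; first by rewrite -G0.
      by exfalso; apply: no; exists G.
    right; split; last by move=> D /F0G GD; exists G.
    have CPe H D : C H -> H D -> semigroup_filter H.
      by move=> /CP[->//|[]].
    split.
      apply: Build_ProperFilter_ex.
        move=> B [H CH HB]; have [PH _] := CPe _ _ CH HB; exact: filter_ex HB.
      split.
      - by exists G => //; have [PG _] := sG; exact: filterT.
      - move=> A B [H CH HA] [H' CH' HB].
        have [PH _] := CPe _ _ CH HA; have [PH' _] := CPe _ _ CH' HB.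
        have [HH'|H'H] := Ctot _ _ CH CH'.
          by exists H' => //; apply: filterI => //; exact: HH'.
        by exists H => //; apply: filterI => //; exact: H'H.
      - move=> A B AB [H CH HA]; have [PH _] := CPe _ _ CH HA.
        by exists H => //; exact: filterS HA.
    move=> p q up uq Cp Cq D [H CH HD]; have [_ sH] := CPe _ _ CH HD.
    by apply: sH => // E HE; [apply: Cp|apply: Cq]; exists H.
  case: PA => [A0|[sA F0A]].
    exfalso; apply: (Amax F0); last by right; split.
    have [PF0 _] := sF0.
    by rewrite A0; split=> [D //|/(_ setT (@filterT _ F0 _))].
  exists A; split=> // G sG AG; apply/seteqP; split=> //.
  apply: contrapT => nGA; apply: (Amax G); first by split.
  by right; split=> // D /F0A /AG.
have [PF mF] := sF.
have [p [up Fp]] := ultraFilterLemma PF.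
(* The right translate by [p] is a closed subsemigroup inside the minimal one, hence equal to it. *)
have FFp : fmul F p = F.
  have sub : F `<=` fmul F p.
    move=> D FD; apply: (@proper_filter_ultra_ext _ F) => q uq Fq.
    exact: (mF q p).
  apply: Fmax => //; split; first exact: fmul_proper.
  move=> q r uq ur Fpq Fpr.
  have [r' [ur' Fr' <-]] := fmul_factor PF up ur Fpr.
  move=> D FpD; rewrite fmulA; apply: mF FpD => //.
  by move=> E /sub /Fpq.
have [r [ur Fr rp]] : exists r, [/\ UltraFilter r, F `<=` r & fmul r p = p].
  by apply: fmul_factor => //; rewrite FFp.
(* The [q] fixing [p] from the left also form a closed subsemigroup, nonempty thanks to [r]; by
   minimality [p] is one of them. *)
pose G := [set A | forall q, UltraFilter q -> F `<=` q -> fmul q p = p -> q A].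
have FG : F `<=` G by move=> A FA q _ Fq _; exact: Fq.
have Gp q : UltraFilter q -> G `<=` q -> fmul q p = p.
  move=> uq Gq; apply: ultra_sub_eq; first exact: fmul_proper.
  by move=> D pD; apply: Gq => q' _ _ q'p; rewrite -q'p in pD.
have GF : G = F.
  apply: Fmax => //; split.
    apply: Build_ProperFilter_ex.
      by move=> B /(_ r ur Fr rp) rB; exact: filter_ex rB.
    split.
    - by move=> q uq _ _; exact: filterT.
    - by move=> A B GA GB q uq Fq qp; apply: filterI; [exact: GA|exact: GB].
    - by move=> A B AB GA q uq Fq qp; apply: filterS AB _; exact: GA.
  move=> q q' uq uq' Gq Gq' A GA; apply: GA.
  - exact: fmul_ultra.
  - by apply: mF => // B /FG; [exact: Gq|exact: Gq'].
  - by rewrite -fmulA (Gp q') // (Gp q).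
exists p; split=> //; first by move=> A /F0F /Fp.
by apply: Gp => //; rewrite GF.
Qed.

End Idempotent.

(** * Idempotent ultrafilters on the dyadic tree *)

Definition level_count (D : set node) (n : nat) : nat :=
  #|[pred t : n.-tuple bool | `[< D t >]]|.

(** These sets form a proper ideal, stable under shifts, that contains every linearly ordered set.
    Every large set of an ultrafilter avoiding the ideal therefore contains two incomparable
    words. *)
Definition thin (D : set node) : Prop := exists k, forall n, (level_count D n <= k)%N.

Lemma thin_sub (D D' : set node) : D `<=` D' -> thin D' -> thin D.
Proof.
move=> DD' [k kP]; exists k => n; apply: leq_trans (kP n).
by apply: subset_leq_card; apply/fintype.subsetP => t; rewrite !inE; exact: DD'.
Qed.

Lemma thinU (D D' : set node) : thin D -> thin D' -> thin (D `|` D').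
Proof.
move=> [k kP] [k' kP']; exists (k + k')%N => n.
apply: leq_trans (leq_add (kP n) (kP' n)); rewrite /level_count -cardUI.
apply: leq_trans (leq_addr _ _); apply: subset_leq_card.
by apply/fintype.subsetP => t; rewrite !inE => -[] /asboolP ->; rewrite ?orbT.
Qed.

Lemma thin_shift (a : node) (D : set node) : thin D -> thin (fshift cat a D).
Proof.
move=> [k kP]; exists k => n; apply: leq_trans (kP (size a + n)%N).
pose g (t : n.-tuple bool) := cat_tuple (in_tuple a) t.
rewrite /level_count -(@card_in_image _ _ g); last first.
  move=> t t' _ _ /(congr1 val) /= /eqP; rewrite eqseq_cat // => /andP[_ /eqP].
  exact: val_inj.
apply: subset_leq_card; apply/fintype.subsetP => _ /fintype.imageP[t + ->].
by rewrite !inE.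
Qed.

Lemma not_thinT : ~ thin setT.
Proof.
have E k : level_count setT k = (2 ^ k)%N.
  rewrite -card_bool -card_tuple; apply: eq_card => t; rewrite !inE.
  by apply/asboolP.
by move=> [k /(_ k)]; rewrite E leqNgt ltn_expl.
Qed.

Lemma thin_total (D : set node) : total_on D (fun s t => prefix s t) -> thin D.
Proof.
move=> tot; exists 1%N => n; apply/card_le1_eqP => s t; rewrite !inE.
move=> Ds Dt; apply: val_inj => /=.
have pE (u v : n.-tuple bool) : prefix u v -> u = v :> seq bool.
  by rewrite prefixE size_tuple -{1}(size_tuple v) take_size => /eqP.
by case: (tot _ _ Ds Dt) => /pE.
Qed.

(* [p (fshift cat a D)] says that almost every extension of [a] lies in [D]. *)
Lemma tree_ultrafilter : exists p : set_system node,
  [/\ UltraFilter p,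
      forall D, p D -> p [set a | p (fshift cat a D)] &
      forall D, p D -> exists s t, [/\ D s, D t, ~~ prefix s t & ~~ prefix t s]].
Proof.
pose F0 : set_system node := [set D | thin (~` D)].
have PF0 : ProperFilter F0.
  split; first by rewrite /F0 /= setC0; exact: not_thinT.
  split.
  - rewrite /F0 /= setCT; apply: thin_total => s t [].
  - by move=> A B; rewrite /F0 /= setCI; exact: thinU.
  - by move=> A B AB; rewrite /F0 /=; apply: thin_sub; exact: subsetC.
have [|p [up F0p pp]] := @idempotent_ultrafilter _ cat (@catA bool) F0.
  split=> // p q up uq F0p F0q D F0D; rewrite /fmul /=.
  by apply: filterE => a; apply: F0q; exact: (thin_shift a F0D).
exists p; split=> // D pD; first by move: pD; rewrite -{1}pp.
apply: contrapT => no.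
have /F0p pnD : F0 (~` D).
  rewrite /F0 /= setCK; apply: thin_total => s t Ds Dt.
  case st: (prefix s t); first by left.
  case ts: (prefix t s); first by right.
  by exfalso; apply: no; exists s, t; rewrite st ts.
exact: filter_setC_false pD pnD.
Qed.

(** * Bad pairs *)

Section Bad.
Variables (K : Type) (p : set_system node).
Hypothesis up : UltraFilter p.
Hypothesis pp : forall D, p D -> p [set a | p (fshift cat a D)].
Variable G : node -> set K.

(** Being inductive, the tree is well-founded: each branch ends after finitely many nodes. [F] and
    [F'] absorb the intersections made along it. *)
Inductive bad : node -> set K -> set K -> Prop :=
| bad_now a F F' : F !=set0 -> F' = set0 -> bad a F F'
| bad_later a F F' D : p D ->
    (forall c, D c -> bad (a ++ c) (F `&` G (a ++ c)) (F' `&` G (a ++ c))) ->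
    bad a F F'.

Lemma bad_witness a F F' : bad a F F' -> exists x, F x /\ ~ F' x.
Proof.
elim=> {a F F'} [a F F' [x Fx] ->|a F F' D pD _ IH]; first by exists x; split.
have [c Dc] := filter_ex pD; have [x [[Fx Gx] nx]] := IH _ Dc.
by exists x; split=> // F'x; apply: nx.
Qed.

(** Overlay the two trees, intersecting their large sets; when one has ended, its set is empty and
    the other tree continues alone. *)
Lemma bad_setU a F F1 F2 : bad a F F1 -> bad a F F2 -> bad a F (F1 `|` F2).
Proof.
move=> b1; elim: b1 F2 => {a F F1} [a F F1 _ -> F2|a F F1 D pD b1 IH F2 b2].
  by rewrite set0U.
case: b2 pD b1 IH => {a F F2} [a F F2 _ ->|a F F2 D2 pD2 b2] pD b1 IH.
  by rewrite setU0; exact: bad_later pD b1.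
apply: (bad_later (filterI pD pD2)) => c [Dc D2c].
by rewrite setIUl; apply: IH => //; exact: b2.
Qed.

(** At a leaf, the alternative depends on whether [F'] has become empty; at an inner node, the
    ultrafilter selects the alternative that holds for almost all successors. *)
Lemma bad_trans a F F' F'' : bad a F F'' -> bad a F F' \/ bad a F' F''.
Proof.
move=> b; elim: b F' => {a F F''} [a F F'' F0 F''0 F'|a F F'' D pD _ IH F'].
  have [F'0|F'0] := pselect (F' !=set0); first by right; exact: bad_now.
  left; apply: bad_now => //; apply/seteqP; split=> // x F'x.
  by apply: F'0; exists x.
pose E := [set c | bad (a ++ c) (F `&` G (a ++ c)) (F' `&` G (a ++ c))].
have [pE|pnE] := in_ultra_setVsetC E up; first by left; exact: bad_later pE _.
right; apply: (bad_later (filterI pD pnE)) => c [Dc nEc].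
by have [/nEc|] := IH c Dc (F' `&` G (a ++ c)).
Qed.

Lemma bad_extend a F F' : bad a F F' -> p [set c | bad (a ++ c) F F'].
Proof.
case=> {a F F'} [a F F' F0 F'0|a F F' D pD b].
  by apply: filterE => c; exact: bad_now.
apply: filterS (pp pD) => c pcD; apply: (bad_later pcD) => d Dcd.
by rewrite -catA; exact: b.
Qed.

(** The successors at which the intersected pair is not bad form a large set [D]. By idempotence [D]
    is large as seen from almost every [c], so it meets the first large set of any tree witnessing
    badness at [a ++ c]. *)
Lemma not_bad_extend a F F' : ~ bad a F F' -> p [set c | ~ bad (a ++ c) F F'].
Proof.
move=> nb.
pose D := [set c | ~ bad (a ++ c) (F `&` G (a ++ c)) (F' `&` G (a ++ c))].
have pD : p D.
  apply: contrapT => npD; apply: nb; apply: (bad_later (ultra_setC up npD)).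
  by move=> c /contrapT.
have badP b E E' : bad b E E' -> E !=set0 /\ E' = set0 \/ exists2 D', p D' &
    forall c, D' c -> bad (b ++ c) (E `&` G (b ++ c)) (E' `&` G (b ++ c)).
  by case=> [{}b {}E {}E' E0 E'0|{}b {}E {}E' D' pD' bD']; [left|right; exists D'].
apply: filterS (pp pD) => c pcD /badP[[F0 F'0]|[D' pD' bD']].
  by apply: nb; exact: bad_now.
have [d [Dcd /bD']] := filter_ex (filterI (pcD : p _) pD').
by rewrite -catA; exact: Dcd.
Qed.

End Bad.

(** * Embeddings of the dyadic tree *)

Lemma dependent_choice_seq (X : Type) (Rel : X -> X -> Prop) (x0 : X) :
  (forall x, exists y, Rel x y) ->
  exists u : nat -> X, u 0%N = x0 /\ forall n, Rel (u n) (u n.+1).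
Proof.
move=> /choice[g gP]; by exists (fun n => iter n g x0); split=> // n.
Qed.

Lemma prefix_anti (s t : node) : prefix s t -> prefix t s -> s = t.
Proof.
move=> /prefixP[u ->] /size_prefix; rewrite size_cat.
by case: u => [|x u]; rewrite ?cats0 // addnS ltnNge leq_addr.
Qed.

Lemma prefix_cat2 (a s t : node) : prefix (a ++ s) (a ++ t) = prefix s t.
Proof. by elim: a => //= x a ->; rewrite eqxx. Qed.

Lemma prefix_common (s t w : node) :
  prefix s w -> prefix t w -> prefix s t \/ prefix t s.
Proof.
elim: w s t => [|x w IH] [|y s] [|z t] //=; try by [left|right].
by move=> /andP[/eqP-> sw] /andP[/eqP-> tw]; rewrite eqxx; exact: IH.
Qed.

Lemma not_prefixP (s t : node) : ~~ prefix s t -> exists u i,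
  prefix (rcons u i) s /\ (t = u \/ prefix (rcons u (~~ i)) t).
Proof.
elim: s t => [|x s IH] [|y t] //=.
  by exists [::], x; split; [rewrite /= eqxx prefix0s|left].
have [<-|xy] := eqVneq x y => /=.
  move=> /IH[u [i [us ut]]]; exists (x :: u), i; rewrite /= eqxx; split=> //.
  by case: ut => [->|ut]; [left|right].
move=> _; exists [::], x; rewrite /= eqxx !prefix0s; split=> //; right.
by case: x y xy => [] [].
Qed.

Definition tree_embedding (phi : node -> node) : Prop :=
  forall s t, prefix (phi s) (phi t) = prefix s t.

Lemma tree_embedding_comp (phi psi : node -> node) :
  tree_embedding phi -> tree_embedding psi -> tree_embedding (phi \o psi).
Proof. by move=> ephi epsi s t; rewrite /= ephi epsi. Qed.

Lemma tree_embedding_inj (phi : node -> node) : tree_embedding phi -> injective phi.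
Proof.
by move=> e s t st; apply: prefix_anti; rewrite -e st prefix_refl.
Qed.

Lemma tree_embedding_sprefix (phi : node -> node) : tree_embedding phi ->
  forall s t, sprefix (phi s) (phi t) = sprefix s t.
Proof. by move=> e s t; rewrite /sprefix e (inj_eq (tree_embedding_inj e)). Qed.

Lemma sprefix_rcons (s t : node) : sprefix s t -> exists i, prefix (rcons s i) t.
Proof.
move=> /andP[st /prefixP[[|i u] tE]]; first by rewrite tE cats0 eqxx in st.
by exists i; rewrite tE -cat_rcons prefix_prefix.
Qed.

Lemma sprefix_prefix_trans (s t u : node) : sprefix s t -> prefix t u -> sprefix s u.
Proof.
move=> st tu; have /andP[_ pst] := st; apply/andP; split; last exact: prefix_trans tu.
apply: contraTneq (sprefix_size st) => su; rewrite -leqNgt su; exact: size_prefix.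
Qed.

Lemma sprefix_rcons_self (s : node) i : sprefix s (rcons s i).
Proof.
apply/andP; split; last exact: prefix_rcons.
by apply: contraTneq (leqnn (size s)) => {1}->; rewrite size_rcons ltnn.
Qed.

Definition splits (a b c : node) : Prop :=
  [/\ prefix a b, prefix a c, ~~ prefix b c & ~~ prefix c b].

(** A state carries data besides its node, so that invariants can be passed down. Order is reflected
    because the images of the two children of the node where words separate are incomparable. *)
Lemma tree_recursion (X : Type) (nd : X -> node) (Rel : X -> X -> Prop) (x0 : X) :
  (forall x, exists y z, [/\ Rel x y, Rel x z & splits (nd x) (nd y) (nd z)]) ->
  exists h : node -> X, [/\ h [::] = x0, forall s i, Rel (h s) (h (rcons s i)) &
    tree_embedding (nd \o h)].
Proof.
move=> step.
have /choice[g gP] : forall x, exists yz : X * X,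
    [/\ Rel x yz.1, Rel x yz.2 & splits (nd x) (nd yz.1) (nd yz.2)].
  by move=> x; have [y [z ?]] := step x; exists (y, z).
pose next x (i : bool) := if i then (g x).1 else (g x).2.
pose h (s : node) := foldl next x0 s.
have hr s i : h (rcons s i) = next (h s) i by rewrite /h -cats1 foldl_cat.
exists h; split=> // [s i|s t].
  by rewrite hr; have [] := gP (h s); case: i.
have mono u v : prefix u v -> prefix (nd (h u)) (nd (h v)).
  move=> /prefixP[w ->]; elim/last_ind: w => [|w i IH].
    by rewrite cats0 prefix_refl.
  rewrite -rcons_cat hr; apply: prefix_trans IH _.
  by have [_ _ []] := gP (h (u ++ w)); case: i.
apply/idP/idP => [|/mono//]; apply: contraTT => /not_prefixP[u [i [us ut]]].
have incomp w : prefix (nd (h (rcons u i))) w ->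
    prefix (nd (h (rcons u (~~ i)))) w -> False.
  move=> wi wi'; have [_ _ [_ _]] := gP (h u).
  case: (prefix_common wi wi'); rewrite !hr; case: i {us ut wi wi'} => /= -> //.
apply/negP => st; have us' := prefix_trans (mono _ _ us) st.
(* If [t = u], the image of one child of [u] would lie below that of [u], hence below that of the
   other child. *)
case: ut => [tu|/mono ut]; last exact: incomp us' ut.
apply: (incomp (nd (h (rcons u (~~ i))))); last exact: prefix_refl.
by apply: prefix_trans us' _; rewrite /= tu; apply: mono; exact: prefix_rcons.
Qed.

Lemma subtree_range (psi : node -> node) : tree_embedding psi -> subtree (range psi).
Proof.
move=> e; have es := tree_embedding_sprefix e; split.
  exists (psi [::]); apply/seteqP; split=> [_ [[s _ <-] smin]|_ ->] /=.
    case: s smin => [//|x s] smin.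
    by have := smin (psi [::]) (ex_intro2 _ _ [::] I erefl); rewrite es.
  split; first by exists [::].
  move=> _ [s _ <-]; rewrite es; apply/negP => /sprefix_size.
  by rewrite ltn0.
move=> _ [s _ <-]; exists (psi (rcons s false)), (psi (rcons s true)); split.
  by move=> /(tree_embedding_inj e)/(congr1 (last false)); rewrite !last_rcons.
apply/seteqP; split=> [_ [[[t _ <-] st] tmin]|].
  move: st; rewrite es => /sprefix_rcons[i it].
  suff -> : t = rcons s i by case: (i); [right|left].
  apply/esym/eqP; apply: contrapT => /negP ti.
  have := tmin (psi (rcons s i)); rewrite !es /sprefix ti it /=.
  move=> /(_ _)/negP; case=> //; split; first by exists (rcons s i).
  by rewrite -/(sprefix _ _) es sprefix_rcons_self.
suff m i : minimal_elements [set u | range psi u /\ sprefix (psi s) u] (psi (rcons s i)).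
  by move=> _ [|] ->.
split; first by split; [exists (rcons s i)|rewrite es sprefix_rcons_self].
move=> _ [[t _ <-]]; rewrite !es => st; apply/negP => /sprefix_size.
by rewrite size_rcons ltnS leqNgt (sprefix_size st).
Qed.

Lemma chain_range (psi : node -> node) (beta : set node) (e : nat -> node) :
  tree_embedding psi -> chain (range psi) beta -> enumerates e beta ->
  exists u : nat -> node, (forall i, sprefix (u i) (u i.+1)) /\ forall i, e i = psi (u i).
Proof.
move=> epsi [sub _ _] [inc re].
have /choice[u uP] : forall i, exists t, e i = psi t.
  move=> i; have /sub[t _ <-] : beta (e i) by rewrite -re; exists i.
  by exists t.
by exists u; split=> // i; rewrite -(tree_embedding_sprefix epsi) -!uP.
Qed.

Lemma prefix_rcons_or (r s : node) i :
  prefix r (rcons s i) -> prefix r s \/ r = rcons s i.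
Proof.
move=> rs; have [|sr] := prefix_common rs (prefix_rcons s i); first by left.
have [->|rn] := eqVneq r (rcons s i); [by right|left].
move: sr rs rn => /prefixP[u ->]; rewrite -cats1 prefix_cat2 eqseq_cat // eqxx /=.
case: u => [|x [|y u]]; rewrite ?cats0 ?prefix_refl //= ?andbT ?andbF //.
by move=> /eqP ->; rewrite eqxx.
Qed.

(** * The hereditary subtree *)

(** The bound [n] is uniform in [x]: this is the combinatorial form in which compactness of the
    space enters. *)
Definition eventually_missed (K : Type) (H : node -> set K) : Prop :=
  forall b : nat -> node, (forall i, sprefix (b i) (b i.+1)) ->
    exists n, forall x, exists2 i, (i <= n)%N & ~ H (b i) x.

Lemma filter_List (T X : Type) (F : set_system T) (Q : X -> T -> Prop) (l : list X) :
  Filter F -> (forall P, List.In P l -> F [set t | Q P t]) ->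
  F [set t | forall P, List.In P l -> Q P t].
Proof.
move=> FF; elim: l => [|P l IH] lF; first by apply: filterE => t P [].
have FP : F [set t | Q P t] by apply: lF; left.
have /(filterI FP) : F [set t | forall P, List.In P l -> Q P t].
  by apply: IH => P' P'l; apply: lF; right.
by apply: filterS => t [QP Ql] P' [<-//|]; exact: Ql.
Qed.

Section Avoid.
Variables (K : Type) (p : set_system node).
Hypothesis up : UltraFilter p.
Hypothesis pp : forall D, p D -> p [set a | p (fshift cat a D)].
Hypothesis pn : forall D, p D ->
  exists s t, [/\ D s, D t, ~~ prefix s t & ~~ prefix t s].
Variable H : node -> set K.
Hypothesis Hfin : eventually_missed H.

Lemma ultra_proper_extension (a : node) : p [set c | sprefix a (a ++ c)].
Proof.
apply: contrapT => /(ultra_setC up)/pn[s [t [+ _ + _]]].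
case: s => [|x s] asx; first by rewrite prefix0s.
move=> _; apply: asx => /=.
by rewrite /sprefix prefix_prefix andbT -{1}(cats0 a) eqseq_cat // eqxx.
Qed.

(* Otherwise there are [b 0 < b 1 < ...] such that, for every [n], a point of
   [F] lies in all of [H (b 0)], ..., [H (b n)]. *)
Lemma not_bad_avoid (G : node -> set K) (a : node) (F : set K) :
  p [set c | ~ bad p G (a ++ c) F (F `&` ~` H (a ++ c))].
Proof.
apply: contrapT => /(ultra_setC up) pB.
pose B b := bad p G b F (F `&` ~` H b).
have {}pB : p [set c | B (a ++ c)].
  by apply: filterS pB => c /contrapT.
(* The second component accumulates the sets [F] minus [H] over the chosen nodes; [bad_setU] keeps
   the pair bad, so [F] always has a point outside the union. *)
pose inv (X : node * set K) := bad p G X.1 F X.2 /\ p [set c | B (X.1 ++ c)].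
pose nxt (X Y : node * set K) :=
  [/\ sprefix X.1 Y.1, X.2 `<=` Y.2 & F `&` ~` H Y.1 `<=` Y.2].
have persist b : p [set c | B (b ++ c)] -> p [set c | p [set d | B ((b ++ c) ++ d)]].
  by move=> /pp; apply: filterS => c; apply: filterS => d; rewrite /fshift /= catA.
have step (X : {X | inv X}) : exists Y : {X | inv X}, nxt (sval X) (sval Y).
  case: X => [[b J] [/= bJ pb]].
  have [c [[[bc pbc] Bc] cJ]] := filter_ex
    (filterI (filterI (filterI (ultra_proper_extension b) (persist _ pb)) pb)
      (bad_extend up pp bJ)).
  have iY : inv (b ++ c, J `|` F `&` ~` H (b ++ c)).
    by split=> //=; by apply: (bad_setU up).
  by exists (exist _ _ iY); split=> //=.
have [c [Bc pc]] := filter_ex (filterI pB (persist _ pB)).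
have i0 : inv (a ++ c, F `&` ~` H (a ++ c)) by split.
have [u [u0 us]] := dependent_choice_seq (exist _ _ i0) step.
pose b n := (sval (u n)).1.
have [|n nP] := Hfin (b := b); first by move=> i; have [] := us i.
have sub i k : F `&` ~` H (b i) `<=` (sval (u (i + k)%N)).2.
  elim: k => [|k IH]; last first.
    by rewrite addnS; have [_ s _] := us (i + k)%N; exact: subset_trans s.
  by rewrite addn0 /b; case: i => [|i]; [rewrite u0|have [] := us i].
have [/(bad_witness up)[x [Fx nx]] _] := svalP (u n).
have [i ni nHi] := nP x; apply: nx.
by rewrite -(subnKC ni); apply: sub.
Qed.

Variables (I : finType) (G : I -> node -> set K).

Definition pairs := list (set K * set K).

(** A pair encodes a set [A] of nodes met so far: the first component is the intersection of [G c]
    over [A], and the second also removes [H] at the other nodes. The new node [t] joins [A] or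
    not. *)
Definition next_pairs (t : node) (c : I) (L : pairs) : pairs :=
  List.app (List.map (fun P => (P.1 `&` G c t, P.2 `&` G c t)) L)
           (List.map (fun P => (P.1, P.2 `&` ~` H t)) L).

Definition fine_pairs (t : node) (L : I -> pairs) : Prop :=
  forall c P, List.In P (L c) -> ~ bad p (G c) t P.1 P.2.

Lemma fine_next (b : node) (L : I -> pairs) : fine_pairs b L ->
  p [set c | fine_pairs (b ++ c) (fun i => next_pairs (b ++ c) i (L i))].
Proof.
move=> fL; apply: filter_forall => i.
have : p [set c | forall P, List.In P (L i) ->
    ~ bad p (G i) (b ++ c) (P.1 `&` G i (b ++ c)) (P.2 `&` G i (b ++ c)) /\
    ~ bad p (G i) (b ++ c) P.1 (P.2 `&` ~` H (b ++ c))].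
  apply: filter_List => P /fL nb.
  have n1 : p [set c |
      ~ bad p (G i) (b ++ c) (P.1 `&` G i (b ++ c)) (P.2 `&` G i (b ++ c))].
    apply: contrapT => /(ultra_setC up) pb; apply: nb.
    by apply: (bad_later pb) => c /contrapT.
  have n2 := not_bad_extend up pp nb.
  (* By [bad_trans] through [P.2], badness of [P.1] against the reduced [P.2] would contradict [n2]
     or [n3]. *)
  have n3 := not_bad_avoid (G i) b P.2.
  apply: filterS (filterI n1 (filterI n2 n3)) => c [? [nb1 nb2]]; split=> //.
  by move=> /(bad_trans up P.2)[].
apply: filterS => c cP P PL.
by case: (List.in_app_or _ _ _ PL) => /(proj1 (List.in_map_iff _ _ _))[Q [<- /cP[]]].
Qed.

Lemma hereditary_embedding : exists psi, tree_embedding psi /\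
  forall s c (A : set node),
    (exists x, forall r, prefix r s -> A r -> G c (psi r) x) ->
    exists x, forall r, prefix r s ->
      (A r -> G c (psi r) x) /\ (~ A r -> ~ H (psi r) x).
Proof.
pose inv (X : node * (I -> pairs)) := fine_pairs X.1 X.2.
have i0 : inv ([::], fun=> [:: (setT, setT)]).
  by move=> c P [<-|//] /= /(bad_witness up)[x []].
pose Rel (X Y : {X | inv X}) :=
  (sval Y).2 = fun i => next_pairs (sval Y).1 i ((sval X).2 i).
have [|h [h0 hR he]] := tree_recursion (nd := fun X => (sval X).1)
    (exist _ _ i0) (Rel := Rel).
  case=> [[b L] /= iX].
  (* Almost all extensions are fine, so two incomparable ones can serve as children. *)
  have [s [t [fs ft st ts]]] := pn (fine_next iX).
  exists (exist _ (b ++ s, fun i => next_pairs (b ++ s) i (L i)) fs),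
         (exist _ (b ++ t, fun i => next_pairs (b ++ t) i (L i)) ft).
  by split=> //=; split; rewrite /= ?prefix_prefix ?prefix_cat2.
(* The shift by [false] drops [h [::]], which is not a node of the subtree. *)
exists (fun s => (sval (h (false :: s))).1); split.
  by move=> s t; rewrite (he (false :: s) (false :: t)).
move=> s c A.
have : exists P, [/\ List.In P ((sval (h (false :: s))).2 c),
   forall x, (forall r, prefix r s -> A r -> G c (sval (h (false :: r))).1 x) -> P.1 x &
   forall x, P.2 x -> forall r, prefix r s ->
     (A r -> G c (sval (h (false :: r))).1 x) /\
     (~ A r -> ~ H (sval (h (false :: r))).1 x)].
  have base t (L : I -> pairs) r0 (P : set K * set K) : List.In P (L c) ->
     t = (sval (h (false :: r0))).1 -> exists P',
     [/\ List.In P' (next_pairs t c (L c)),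
        forall x, P.1 x -> (A r0 -> G c t x) -> P'.1 x &
        forall x, P'.2 x -> P.2 x /\ ((A r0 -> G c t x) /\ (~ A r0 -> ~ H t x))].
    move=> PL _; have [Ar|nAr] := pselect (A r0).
      exists (P.1 `&` G c t, P.2 `&` G c t); split=> [|x Px Gx|x [Px Gx]].
      - by apply: List.in_or_app; left; apply: (proj2 (List.in_map_iff _ _ _)); exists P.
      - by split=> //; exact: Gx.
      - by split.
    exists (P.1, P.2 `&` ~` H t); split=> [|x Px Gx|x [Px Gx]] //.
    by apply: List.in_or_app; right; apply: (proj2 (List.in_map_iff _ _ _)); exists P.
  elim/last_ind: s => [|s i [P [PL P1 P2]]].
    have := hR [::] false; rewrite /Rel h0 /= => ->.
    have [|P' [P'L P'1 P'2]] := base (sval (h [:: false])).1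
        (fun=> [:: (setT, setT)]) [::] (setT, setT) _ erefl; first by left.
    exists P'; split=> // x; last by move=> /P'2[_ ?] [].
    by move=> xG; apply: P'1 => // A0; exact: xG.
  have := hR (false :: s) i; rewrite /Rel /= => ->.
  have [P' [P'L P'1 P'2]] := base (sval (h (false :: rcons s i))).1 _ (rcons s i) P PL erefl.
  exists P'; split=> // x.
    move=> xG; apply: P'1.
      by apply: P1 => r rs; apply: xG; exact: prefix_trans (prefix_rcons _ _).
    by apply: xG; exact: prefix_refl.
  move=> /P'2[/P2 xr xs] r rs.
  by case: (prefix_rcons_or rs) => [/xr|->].
move=> [P [PL P1 P2]] [x /P1 Px].
suff [y /P2 yP] : P.2 !=set0 by exists y.
(* A pair that is not bad and has a nonempty first set has a nonempty second set, by [bad_now]. *)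
apply: contrapT => P20; have [h1 h2] := (svalP (h (false :: s)), PL).
apply: (h1 c P h2); apply: bad_now; first by exists x.
by apply/seteqP; split=> // y Py; apply: P20; exists y.
Qed.

End Avoid.

Local Open Scope ring_scope.

(** * Branches, compactness and the gap condition *)

Section Branch.
Variable b : nat -> node.
Hypothesis b_inc : forall i, sprefix (b i) (b i.+1).

(** The hypotheses on the family concern maximal chains, so an increasing sequence is completed
    downwards. *)
Definition branch : set node := [set s | exists i, prefix s (b i)].

Lemma sprefix_seq_mono i j : (i <= j)%N -> prefix (b i) (b j).
Proof.
elim: j => [|j IH]; first by rewrite leqn0 => /eqP->; exact: prefix_refl.
rewrite leq_eqVlt => /orP[/eqP->|/IH ij]; first exact: prefix_refl.
by apply: prefix_trans ij _; case/andP: (b_inc j).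
Qed.

Lemma sprefix_seq_size i : (i <= size (b i))%N.
Proof. by elim: i => // i IH; apply: leq_ltn_trans IH (sprefix_size (b_inc i)). Qed.

Lemma branch_maximal : maximal_chain [set: node] branch.
Proof.
have tot : total_on branch (fun s t => prefix s t).
  move=> s t [i si] [j tj]; apply: (@prefix_common _ _ (b (maxn i j))).
    exact: prefix_trans si (sprefix_seq_mono (leq_maxl _ _)).
  exact: prefix_trans tj (sprefix_seq_mono (leq_maxr _ _)).
have inf : infinite_set branch.
  move=> /finite_fsetP[X bX].
  pose n := (\max_(s <- finmap.enum_fset X) size s)%N.
  have : branch (b n.+1) by exists n.+1; exact: prefix_refl.
  rewrite bX => bnX; have := sprefix_seq_size n.+1.
  by rewrite leqNgt ltnS (@leq_bigmax_seq _ _ xpredT (fun s : node => size s)).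
split=> // gamma [_ _ gtot] bg; apply/seteqP; split=> // t gt.
have gb : gamma (b (size t)) by apply: bg; exists (size t); exact: prefix_refl.
have [tb|bt] := gtot _ _ gt gb; first by exists (size t).
exists (size t); suff tE : t = b (size t) by rewrite {1}tE prefix_refl.
apply/esym; apply: contrapT => /eqP nbt.
have : sprefix (b (size t)) t by rewrite /sprefix nbt.
by move=> /sprefix_size; rewrite ltnNge sprefix_seq_size.
Qed.

End Branch.

(** * Comparison of the Euclidean norm with coordinates *)

Section Enorm.
Variables (R : realType) (m : nat).
Implicit Types v : 'rV[R]_m.

Lemma enorm_ge0 v : 0 <= enorm v.
Proof. exact: sqrtr_ge0. Qed.

Lemma enorm0 : enorm (0 : 'rV[R]_m) = 0.
Proof. by rewrite /enorm big1 ?sqrtr0 // => j _; rewrite mxE expr0n. Qed.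

Lemma enorm_ge_coord v j : `|v 0 j| <= enorm v.
Proof.
rewrite -sqrtr_sqr ler_wsqrtr // (bigD1 j) //= lerDl.
by apply: sumr_ge0 => k _; exact: sqr_ge0.
Qed.

Lemma enorm_le_sum v : enorm v <= \sum_j `|v 0 j|.
Proof.
have s0 : 0 <= \sum_j `|v 0 j| by apply: sumr_ge0.
rewrite -[leRHS]ger0_norm // -sqrtr_sqr ler_wsqrtr // expr2 mulr_suml.
apply: ler_sum => j _; rewrite -[v 0 j ^+ 2]real_normK ?num_real // expr2.
by rewrite ler_wpM2l // (bigD1 j) //= lerDl sumr_ge0.
Qed.

Lemma enorm_le_coord v mu : (0 < m)%N -> mu <= enorm v ->
  exists j, mu / m%:R <= `|v 0 j|.
Proof.
move=> m0 mv; apply: contrapT => no.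
have mR : 0 < m%:R :> R by rewrite ltr0n.
have : \sum_j `|v 0 j| < \sum_(j < m) mu / m%:R.
  apply: ltr_sum => [|j _].
    by apply/hasP; exists (Ordinal m0); rewrite ?mem_index_enum.
  by rewrite ltNge; apply/negP => mj; apply: no; exists j.
rewrite sumr_const card_ord -(mulr_natr (mu / m%:R)) divfK ?gt_eqF // ltNge.
by rewrite (le_trans mv (enorm_le_sum v)).
Qed.

Lemma enorm_continuous : continuous (@enorm R m).
Proof.
move=> v; apply: (@continuous_comp _ _ _ (fun v : 'rV[R]_m => \sum_(j < m) v 0 j ^+ 2)
  Num.sqrt); last exact: sqrt_continuous.
apply: continuous_big => [|j _]; first exact: add_continuous.
move=> w; apply: (@continuous_comp _ _ _ (fun v : 'rV[R]_m => v 0 j) (fun r => r ^+ 2)).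
  exact: coord_continuous.
exact: exprn_continuous.
Qed.

End Enorm.

(** Otherwise the decreasing sets [C n] are all nonempty, and a cluster point of them lies in every
    closed set [H (b i)]. *)
Lemma compact_eventually_missed (K : topologicalType) (H : node -> set K) :
  compact [set: K] -> (forall s, closed (H s)) ->
  (forall b : nat -> node, (forall i, sprefix (b i) (b i.+1)) ->
     forall x, exists i, ~ H (b i) x) ->
  eventually_missed H.
Proof.
move=> cK cH pH b b_inc; apply: contrapT => no.
pose C n := [set x | forall i, (i <= n)%N -> H (b i) x].
have C0 n : C n !=set0.
  apply: contrapT => Cn0; apply: no; exists n => x.
  apply: contrapT => xn; apply: Cn0; exists x => i ni.
  by apply: contrapT => nHi; apply: xn; exists i.
have PF : ProperFilter (filter_from setT C).
  apply: filter_from_proper => // .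
  apply: filter_fromT_filter; first by exists 0%N.
  move=> i j; exists (maxn i j) => x Cx; split=> k ki; apply: Cx.
    exact: leq_trans ki (leq_maxl _ _).
  exact: leq_trans ki (leq_maxr _ _).
have [|x [_ cx]] := cK _ PF; first by exists 0%N.
have [i nHi] := pH b b_inc x; apply: nHi; apply: cH => B /cx; apply.
by exists i => // y; apply.
Qed.

(** * One gap constant and prescribed errors on a subtree *)

Section Gap.
Variables (R : realType) (K : topologicalType) (m : nat) (f : node -> K -> 'rV[R]_m).
Hypothesis f_gap : forall beta : set node, maximal_chain [set: node] beta ->
  exists (eps : nat -> R) (mu : R),
    [/\ forall n, 0 < eps n, eps n @[n --> \oo] --> (0 : R), 0 < mu &
        forall s, beta s -> forall x,
          enorm (f s x) <= eps (size s) \/ mu <= enorm (f s x)].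

Definition gapped (s : node) (eps mu : R) : Prop :=
  forall x, enorm (f s x) <= eps \/ mu <= enorm (f s x).

Lemma small_along_sprefix (b : nat -> node) (x : K) (mu : R) :
  (forall (beta : set node) (e : nat -> node),
    maximal_chain [set: node] beta -> enumerates e beta ->
    forall x, f (e i) x @[i --> \oo] --> (0 : 'rV[R]_m)) ->
  (forall i, sprefix (b i) (b i.+1)) -> 0 < mu ->
  exists i, enorm (f (b i) x) < mu.
Proof.
move=> f_cvg0 b_inc mu0; have mb := branch_maximal b_inc.
have [e [ee _]] := chain_enumeration (proj1 mb).
have : enorm (f (e i) x) @[i --> \oo] --> (0 : R).
  rewrite -(enorm0 R m); apply: continuous_cvg; first exact: enorm_continuous.
  exact: f_cvg0 mb ee x.
move=> /cvgrPdist_lt/(_ _ mu0)[N _ NP].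
(* This node is at least as long as [e N], so it occurs in the enumeration at some position
   [j >= N]. *)
have : range e (b (size (e N))).
  by rewrite (proj2 ee); exists (size (e N)); exact: prefix_refl.
move=> [j _ jE]; exists (size (e N)); rewrite -jE.
have /= := NP j; rewrite sub0r normrN ger0_norm ?enorm_ge0 //; apply.
rewrite leqNgt; apply/negP => /(enumerates_size ee).
by rewrite jE ltnNge sprefix_seq_size.
Qed.

(* Otherwise a branch can be built on which no [mu] works. *)
Lemma uniform_gap : exists (s0 : node) (mu : R), [/\ 0 < mu, mu <= 1 &
  forall s, prefix s0 s -> forall eps, 0 < eps ->
    exists2 t, prefix s t & gapped t eps mu].
Proof.
apply: contrapT => no.
have step (X : node * nat) : exists Y : node * nat, [/\ sprefix X.1 Y.1,
    Y.2 = X.2.+1 & exists2 eps, 0 < eps &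
    forall t, prefix Y.1 t -> ~ gapped t eps (X.2.+1%:R^-1)].
  apply: contrapT => noX; apply: no.
  (* Starting from a child of [X.1] makes the next node a proper extension. *)
  exists (rcons X.1 true), (X.2.+1%:R^-1); split; first by rewrite invr_gt0 ltr0n.
    by rewrite invf_le1 ?ltr0n // ler1n.
  move=> s Xs eps eps0; apply: contrapT => nt; apply: noX.
  exists (s, X.2.+1); split=> //=.
    exact: sprefix_prefix_trans (sprefix_rcons_self _ _) Xs.
  by exists eps => // t st gt; apply: nt; exists t.
have [u [u0 us]] := dependent_choice_seq ([::], 0%N) step.
have u2 n : (u n).2 = n.
  by elim: n => [|n IH]; [rewrite u0|have [_ -> _] := us n; rewrite IH].
pose b n := (u n).1.
have b_inc i : sprefix (b i) (b i.+1) by have [] := us i.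
have [eps [mu [eps0 epsc mu0 gap]]] := f_gap (branch_maximal b_inc).
have [k kmu] : exists k : nat, k.+1%:R^-1 < mu.
  have := near_infty_natSinv_lt (PosNum mu0).
  by move=> [N _ NP]; exists N; apply: NP => /=.
have [_ _ [d d0 dP]] := us k.
have [N _ NP] := (cvgrPdist_lt _ _).1 epsc _ d0.
(* Past stage [k.+1] the constant [1/(k+1)] fails with error [d]; past [N] the error of the branch
   is below [d]. *)
pose j := maxn k.+1 N.
apply: (dP (b j)); first exact: (sprefix_seq_mono b_inc (leq_maxl _ _)).
rewrite u2 => x; have [|ex|mx] := gap (b j) _ x.
- by exists j; exact: prefix_refl.
- left; apply: le_trans ex _; apply: ltW.
  have /= := NP (size (b j)); rewrite sub0r normrN gtr0_norm //; apply.
  exact: leq_trans (leq_maxr _ _) (sprefix_seq_size b_inc j).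
- by right; apply: le_trans (ltW kmu) mx.
Qed.

(** The constant [mu] comes before [eps] because the errors will be chosen small relative to it. *)
Lemma gapped_embedding : exists mu : R, [/\ 0 < mu, mu <= 1 &
  forall eps : nat -> R, (forall n, 0 < eps n) ->
    exists2 phi, tree_embedding phi & forall s, gapped (phi s) (eps (size s)) mu].
Proof.
have [s0 [mu [mu0 mu1 ext]]] := uniform_gap; exists mu; split=> // eps eps0.
pose X := {X : node * nat | prefix s0 X.1}.
pose Rel (Y Z : X) := (sval Z).2 = (sval Y).2.+1 /\
  gapped (sval Z).1 (eps (sval Y).2) mu.
have x0P : prefix s0 (s0, 0%N).1 by exact: prefix_refl.
have [|h [h0 hR he]] := tree_recursion (nd := fun Y : X => (sval Y).1)
    (exist _ (s0, 0%N) x0P) (Rel := Rel).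
  case=> [[b k] /= sb].
  have sbi i : prefix s0 (rcons b i) by apply: prefix_trans sb (prefix_rcons _ _).
  have [s bs gs] := ext _ (sbi false) _ (eps0 k).
  have [t bt gt] := ext _ (sbi true) _ (eps0 k).
  have s0s := prefix_trans (sbi _) bs; have s0t := prefix_trans (sbi _) bt.
  exists (exist _ (s, k.+1) s0s), (exist _ (t, k.+1) s0t); split=> //.
  have incomp w : prefix (rcons b false) w -> prefix (rcons b true) w -> False.
    move=> fw tw; case: (prefix_common fw tw); rewrite -!cats1 prefix_cat2 //.
  split=> /=; try exact: prefix_trans (prefix_rcons _ _) _.
  - exact: prefix_trans (prefix_rcons _ _) bs.
  - exact: prefix_trans (prefix_rcons _ _) bt.
  - by apply/negP => st; apply: (incomp t) => //; exact: prefix_trans st.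
  - by apply/negP => ts; apply: (incomp s) => //; exact: prefix_trans ts.
have hs s : (sval (h s)).2 = size s.
  elim/last_ind: s => [|s i IH]; first by rewrite h0.
  by have [-> _] := hR s i; rewrite IH size_rcons.
(* No gap is imposed on [h [::]]; dropping it also makes the index of the error equal to
   [size s]. *)
exists (fun s => (sval (h (false :: s))).1).
  by move=> s t; rewrite (he (false :: s) (false :: t)).
move=> s; case/lastP: s => [|s i].
  by have [_] := hR [::] false; rewrite hs.
by have [_] := hR (false :: s) i; rewrite hs size_rcons.
Qed.

End Gap.

(** * The unconditionality estimate *)

Section Supnorm.
Variables (R : realType) (K : Type) (m : nat).
Implicit Types g : K -> 'rV[R]_m.

Lemma enorm_le_supnorm g (M : R) x :
  (forall x, enorm (g x) <= M) -> enorm (g x) <= supnorm g.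
Proof.
move=> gM; apply: ub_le_sup; last by exists x.
by exists M => _ [z _ <-].
Qed.

Lemma supnorm_empty g : ~ (exists x : K, True) -> supnorm g = 0.
Proof.
move=> E0; rewrite -(@sup0 R); congr sup.
by apply/seteqP; split=> // r [x _ _]; apply: E0; exists x.
Qed.

Lemma supnorm_le g (M : R) : 0 <= M -> (forall x, enorm (g x) <= M) -> supnorm g <= M.
Proof.
move=> M0 gM; have [[x _]|E0] := pselect (exists x : K, True).
  by apply: ge_sup; [exists (enorm (g x)), x|move=> _ [z _ <-]].
by rewrite supnorm_empty.
Qed.

(** Since [sup] defaults to 0 on empty or unbounded sets, a nonzero value certifies boundedness. *)
Lemma supnorm_bounded g x : supnorm g != 0 -> enorm (g x) <= supnorm g.
Proof.
move=> g0; apply: ub_le_sup; last by exists x.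
have [[]//|/sup_out g00] := pselect (has_sup (range (fun x => enorm (g x)))).
by rewrite /supnorm g00 eqxx in g0.
Qed.

Lemma supnorm_gt g (r : R) : 0 <= r -> r < supnorm g -> exists x, r < enorm (g x).
Proof.
move=> r0 rg.
have [|_ [x _ <-] rx] := @sup_gt R (range (fun x => enorm (g x))) r _ rg;
  last by exists x.
apply/set0P; apply: contraTneq rg => /= g0.
by rewrite /supnorm g0 sup0 -leNgt.
Qed.

End Supnorm.

Section Estimate.
Variables (R : realType) (K : Type) (m n : nat) (y : 'I_n -> K -> 'rV[R]_m).
Variables (mu : R) (delta : 'I_n -> R).
Hypotheses (m_gt0 : (0 < m)%N) (mu0 : 0 < mu) (mu1 : mu <= 1).
Hypothesis y1 : forall i, supnorm (y i) = 1.
Hypothesis delta0 : forall i, 0 <= delta i.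
Let nu := mu / m%:R.
Hypothesis delta_sum : \sum_i delta i <= nu / 2.
Hypothesis y_gap : forall i x, enorm (y i x) <= delta i \/ mu <= enorm (y i x).
Hypothesis y_hereditary : forall (j : 'I_m) (sg : bool) (P : pred 'I_n),
  (exists x, forall i, P i -> nu <= (-1) ^+ sg * y i x 0 j) ->
  exists x, forall i, if P i then nu <= (-1) ^+ sg * y i x 0 j
                      else enorm (y i x) <= delta i.
Variable a : 'I_n -> R.
Let b := supnorm (\sum_i a i *: y i).
Let s := \sum_i `|a i| * delta i.

Let nu0 : 0 < nu. Proof. by rewrite divr_gt0 // ltr0n. Qed.

Let y_le1 i x : enorm (y i x) <= 1.
Proof. by rewrite -(y1 i); apply: supnorm_bounded; rewrite y1 oner_eq0. Qed.

Let coord_le1 i x j : `|y i x 0 j| <= 1.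
Proof. exact: le_trans (enorm_ge_coord _ _) (y_le1 i x). Qed.

Let coordE (P : pred 'I_n) x j :
  (\sum_(i | P i) a i *: y i) x 0 j = \sum_(i | P i) a i * y i x 0 j.
Proof. by rewrite fct_sumE summxE; apply: eq_bigr => i _; rewrite mxE. Qed.

Let coord_le_b x j : `|\sum_i a i * y i x 0 j| <= b.
Proof.
rewrite -(coordE xpredT); apply: le_trans (enorm_ge_coord _ _) _.
apply: (@enorm_le_supnorm _ _ _ _ (\sum_(j < m) \sum_i `|a i|)) => z.
apply: le_trans (enorm_le_sum _) _; apply: ler_sum => k _.
rewrite (coordE xpredT); apply: le_trans (ler_norm_sum _ _ _) _.
by apply: ler_sum => i _; rewrite normrM ler_piMr.
Qed.

Let s0 : 0 <= s. Proof. by apply: sumr_ge0 => i _; rewrite mulr_ge0. Qed.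

Let b0 : 0 <= b.
Proof.
rewrite /b; have [[x _]|E0] := pselect (exists x : K, True).
  exact: le_trans (normr_ge0 _) (coord_le_b x (Ordinal m_gt0)).
by rewrite supnorm_empty.
Qed.

(** At the point [z] given by heredity, the terms in [P] have equal signs and size at least
    [nu * |a i|], while the others contribute at most [s]. *)
Lemma signed_sum_le (j : 'I_m) (sg tau : bool) (P : pred 'I_n) :
  (forall i, P i -> 0 <= (-1) ^+ tau * a i) ->
  (exists x, forall i, P i -> nu <= (-1) ^+ sg * y i x 0 j) ->
  nu * \sum_(i | P i) `|a i| <= b + s.
Proof.
move=> aP /y_hereditary[z zP].
have sP : `|\sum_(i | P i) a i * y i z 0 j| <= b + s.
  have -> : \sum_(i | P i) a i * y i z 0 j =
      \sum_i a i * y i z 0 j - \sum_(i | ~~ P i) a i * y i z 0 j.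
    by rewrite [\sum_i _](bigID P) /= addrK.
  apply: le_trans (ler_normB _ _) (lerD (coord_le_b _ _) _).
  apply: le_trans (ler_norm_sum _ _ _) _.
  rewrite /s [leRHS](bigID (fun i => ~~ P i)) /=; apply: ler_wpDr.
    by apply: sumr_ge0 => i _; rewrite mulr_ge0.
  apply: ler_sum => i nPi; rewrite normrM ler_wpM2l //.
  apply: le_trans (enorm_ge_coord _ _) _.
  by have := zP i; rewrite (negPf nPi).
apply: le_trans sP.
have -> : `|\sum_(i | P i) a i * y i z 0 j| =
    `|\sum_(i | P i) ((-1) ^+ tau * a i) * ((-1) ^+ sg * y i z 0 j)|.
  rewrite [in RHS](eq_bigr (fun i => ((-1) ^+ tau * (-1) ^+ sg) * (a i * y i z 0 j))).
    by rewrite -mulr_sumr !normrM !normr_sign !mul1r.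
  by move=> i _; rewrite mulrACA.
apply: le_trans (ler_norm _); rewrite mulr_sumr; apply: ler_sum => i Pi.
have -> : `|a i| = (-1) ^+ tau * a i.
  by rewrite -[RHS]ger0_norm ?aP // normrM normr_sign mul1r.
by rewrite mulrC ler_wpM2l ?aP //; have := zP i; rewrite Pi.
Qed.

Lemma big_coord i x : mu <= enorm (y i x) ->
  exists (j : 'I_m) (sg : bool), nu <= (-1) ^+ sg * y i x 0 j.
Proof.
move=> /(enorm_le_coord m_gt0)[j nuj]; exists j, (y i x 0 j < 0).
by rewrite -normrEsign.
Qed.

(** Singletons [P] give [nu * |a i| <= b + s]; weighting by [delta], of total at most [nu / 2],
    yields [s <= (b + s) / 2]. *)
Lemma small_part_le : s <= b.
Proof.
have ai i : nu * `|a i| <= b + s.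
  have [x hx] : exists x, mu <= enorm (y i x).
    (* As [delta i <= nu / 2 <= 1 / 2], a value above [1 / 2] excludes the small alternative. *)
    have h1 : 1 / 2 < supnorm (y i) by rewrite y1; lra.
    have [|x hx] := supnorm_gt _ h1; first by lra.
    exists x; have [yd|//] := y_gap i x.
    have : delta i <= nu / 2.
      by apply: le_trans delta_sum; rewrite (bigD1 i) //= lerDl sumr_ge0.
    have : nu <= 1.
      rewrite ler_pdivrMr ?ltr0n // mul1r; apply: le_trans mu1 _.
      by rewrite ler1n.
    lra.
  have [j [sg hj]] := big_coord hx.
  rewrite -[`|a i|](big_pred1_eq +%R i (fun i => `|a i|)).
  apply: (@signed_sum_le j sg (a i < 0)) => [k /eqP->|]; first by rewrite -normrEsign.
  by exists x => k /eqP->.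
have : nu * s <= (b + s) * (nu / 2).
  apply: le_trans (ler_wpM2l (addr_ge0 b0 s0) delta_sum).
  rewrite !mulr_sumr; apply: ler_sum => i _.
  by rewrite mulrA ler_wpM2r.
rewrite mulrCA ler_pM2l //; lra.
Qed.

(** In each of the [m] coordinates, small values contribute at most [s <= b]. The large ones fall
    into [4 * m] classes, by coordinate, sign of the value and sign of the coefficient, each
    contributing at most [(b + s) / nu <= 2 * b / nu]. *)
Lemma unconditional_estimate (A : {set 'I_n}) :
  supnorm (\sum_(i in A) a i *: y i) <= m%:R * (1 + 8 * m%:R / nu) * b.
Proof.
have C0 : 0 <= m%:R * (1 + 8 * m%:R / nu) :> R.
  by rewrite mulr_ge0 // addr_ge0 // divr_ge0 ?(ltW nu0) // mulr_ge0.
apply: supnorm_le => [|x]; first exact: mulr_ge0.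
apply: le_trans (enorm_le_sum _) _.
have -> : m%:R * (1 + 8 * m%:R / nu) * b = \sum_(j < m) ((1 + 8 * m%:R / nu) * b).
  by rewrite sumr_const card_ord -[RHS]mulr_natl mulrA.
apply: ler_sum => j _; rewrite (coordE (mem A)).
apply: le_trans (ler_norm_sum _ _ _) _.
pose P (q : 'I_m * bool * bool) i :=
  (nu <= (-1) ^+ q.1.2 * y i x 0 q.1.1) && (0 <= (-1) ^+ q.2 * a i).
have term i : `|a i * y i x 0 j| <=
    `|a i| * delta i + \sum_q (if P q i then `|a i| else 0).
  rewrite normrM; have [yd|/big_coord[k [sg hk]]] := y_gap i x.
    apply: ler_wpDr; first by apply: sumr_ge0 => q _; case: ifP.
    by rewrite ler_wpM2l //; apply: le_trans (enorm_ge_coord _ _) yd.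
  apply: ler_wpDl; first by rewrite mulr_ge0.
  rewrite (bigD1 (k, sg, a i < 0)) //= /P /= hk -normrEsign normr_ge0 /=.
  apply: ler_wpDr; first by apply: sumr_ge0 => q _; case: ifP.
  by rewrite ler_piMr.
apply: le_trans (ler_sum _ (fun i _ => term i)) _.
rewrite big_split /= mulrDl mul1r; apply: lerD.
  apply: le_trans small_part_le; rewrite /s [leRHS](bigID (mem A)) /=.
  by apply: ler_wpDr => //; apply: sumr_ge0 => i _; rewrite mulr_ge0.
rewrite exchange_big /=.
have -> : 8 * m%:R / nu * b = \sum_(q : 'I_m * bool * bool) (2 * b / nu).
  rewrite sumr_const !card_prod card_ord !card_bool -[RHS]mulr_natl !natrM.
  by field; rewrite gt_eqF.
apply: ler_sum => q _.
apply: (@le_trans _ _ (\sum_(i | P q i) `|a i|)).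
  rewrite [leRHS]big_mkcond /= [leRHS](bigID (mem A)) /=.
  by apply: ler_wpDr => //; apply: sumr_ge0 => i _; case: ifP.
rewrite ler_pdivlMr // mulrC; apply: (@le_trans _ _ (b + s)).
  apply: (@signed_sum_le q.1.1 q.1.2 q.2) => [i /andP[]//|].
  by exists x => i /andP[].
by have := small_part_le; lra.
Qed.

End Estimate.

Lemma sum_half_powers (R : realType) (c : R) (n : nat) : 0 <= c ->
  \sum_(i < n) c / 2 ^+ i.+2 <= c / 2.
Proof.
move=> c0; suff -> : \sum_(i < n) c / 2 ^+ i.+2 = c / 2 - c / 2 ^+ n.+1.
  by rewrite gerBl divr_ge0 // exprn_ge0.
elim: n => [|n IH]; first by rewrite big_ord0 subrr.
rewrite big_ord_recr /= IH !exprS; field.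
by rewrite expf_neq0 // pnatr_eq0.
Qed.

(** * Assembly of the subtree and its constant *)

Theorem theorem3p3 (R : realType) (K : topologicalType)
    (K_compact : compact [set: K]) (K_hausdorff : hausdorff_space K)
    (m : nat) (m_gt0 : (0 < m)%N)
    (f : node -> K -> 'rV[R]_m)
    (f_cont : forall s, continuous (f s))
    (f_normalized : forall s, supnorm (f s) = 1)
    (f_bounded_cvg0 : forall (beta : set node) (e : nat -> node),
       maximal_chain [set: node] beta -> enumerates e beta ->
       (exists M : R, forall i x, enorm (f (e i) x) <= M) /\
       (forall x, f (e i) x @[i --> \oo] --> (0 : 'rV[R]_m)))
    (f_gap : forall beta : set node, maximal_chain [set: node] beta ->
       exists (eps : nat -> R) (mu : R),
         [/\ forall n, 0 < eps n, eps n @[n --> \oo] --> (0 : R), 0 < mu &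
             forall s, beta s -> forall x,
               enorm (f s x) <= eps (size s) \/ mu <= enorm (f s x)]) :
  exists (T : set node) (C : R),
    [/\ subtree T, 1 <= C &
        forall (beta : set node) (e : nat -> node),
          chain T beta -> enumerates e beta ->
          unconditional (@supnorm R K m) C (fun i => f (e i))].
Proof.
have cvg0 beta e mb ee := proj2 (f_bounded_cvg0 beta e mb ee).
have [mu [mu0 mu1 emb]] := gapped_embedding f_gap.
pose nu := mu / m%:R; have nu0 : 0 < nu by rewrite divr_gt0 // ltr0n.
(* The exponent [n.+2] makes the errors sum to at most [nu / 2], as the estimate requires. *)
pose eps n := nu / 2 ^+ n.+2.
have eps0 n : 0 < eps n by rewrite divr_gt0 // exprn_gt0.
have [phi ephi gphi] := emb eps eps0.
pose H s := [set x | mu <= enorm (f (phi s) x)].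
have H_missed : eventually_missed H.
  apply: compact_eventually_missed => // [s|b b_inc x].
    apply: (@closed_comp _ _ (@enorm R m \o f (phi s)) [set r | mu <= r]).
      move=> x _; apply: continuous_comp; first exact: f_cont.
      exact: enorm_continuous.
    exact: closed_ge.
  have b'_inc i : sprefix (phi (b i)) (phi (b i.+1)).
    by rewrite tree_embedding_sprefix.
  have [i ilt] := small_along_sprefix x cvg0 b'_inc mu0.
  by exists i; rewrite /H /= => /(lt_le_trans ilt); rewrite ltxx.
have [p [up pp pn]] := tree_ultrafilter.
have [psi [epsi psiP]] := hereditary_embedding up pp pn H_missed
  (fun (c : 'I_m * bool) s => [set x | nu <= (-1) ^+ c.2 * f (phi s) x 0 c.1]).
have e_comp := tree_embedding_comp ephi epsi.
exists (range (phi \o psi)), (m%:R * (1 + 8 * m%:R / nu)).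
split; first exact: subtree_range.
  have m1 : 1 <= m%:R :> R by rewrite ler1n.
  rewrite -[leLHS]mulr1 ler_pM //.
  by rewrite lerDl divr_ge0 ?(ltW nu0) // mulr_ge0.
move=> beta e cb ee n a A.
have [u [u_inc uE]] := chain_range e_comp cb ee.
have psiu_inc i : sprefix (psi (u i)) (psi (u i.+1)).
  by rewrite tree_embedding_sprefix.
have u_inj : injective u.
  move=> i j uij; case: (ltngtP i j) => // ij; exfalso.
    have := enumerates_size ee ij; rewrite !uE uij ltnn //.
  by have := enumerates_size ee ij; rewrite !uE uij ltnn.
pose delta (i : 'I_n) := eps i.
have small (i : nat) x : ~ H (psi (u i)) x -> enorm (f (e i) x) <= eps i.
  move=> nH; rewrite uE; have [hx|//] := gphi (psi (u i)) x.
  (* The [i]-th node of a chain has length at least [i], so its error is at most [eps i]. *)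
  apply: le_trans hx _; rewrite ler_pM2l // lef_pV2 ?posrE ?exprn_gt0 //.
  by rewrite ler_eXn2l ?ltr1n // !ltnS; exact: (@sprefix_seq_size (psi \o u)).
apply: (@unconditional_estimate R K m n (fun i => f (e i)) mu delta) => //.
- by move=> i; exact: (ltW (eps0 i)).
- exact: (sum_half_powers n (ltW nu0)).
- move=> i x; have [hx|nhx] := pselect (H (psi (u i)) x); last by left; exact: small.
  by right; rewrite uE.
move=> j sg P [x xP].
pose A' : set node := [set r | exists2 i : 'I_n, P i & r = u i].
(* The node [u n] lies above all [u i] with [i < n], so one point [z] serves them all. *)
have [|z zP] := psiP (u n) (j, sg) A'.
  by exists x => _ _ [i Pi ->] /=; have := xP i Pi; rewrite uE.
exists z => i; have [zG znH] := zP (u i) (sprefix_seq_mono u_inc (ltnW (ltn_ord i))).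
case: ifPn => Pi; first by rewrite uE; apply: zG; exists i.
apply: small; apply: znH => -[k Pk] /u_inj /val_inj ik.
by rewrite ik Pk in Pi.
Qed.
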